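(* Let $\lambda_1,\lambda_2>0$, $\alpha_1,\alpha_2\in(0,1)$, and let $S_{\alpha_1,\alpha_2}(t)=N_1(D_{\alpha_1}(t))-N_2(D_{\alpha_2}(t))$ be the space-fractional Skellam process. Its probability mass function $H_k(t)=\mathbb{P}(S_{\alpha_1,\alpha_2}(t)=k)$, $k\in\mathbb{Z}$, is given by $$\begin{aligned}H_k(t)&=\sum_{n=0}^\infty\frac{(-1)^k}{n!(n+k)!}\left({}_1\psi_1\left[\begin{matrix}(1,\alpha_1);\\(1-n-k,\alpha_1);\end{matrix}(-\lambda_1^{\alpha_1}t)\right]\right)\left({}_1\psi_1\left[\begin{matrix}(1,\alpha_2);\\(1-n,\alpha_2);\end{matrix}(-\lambda_2^{\alpha_2}t)\right]\right)\mathbb{I}_{k\ge0}\\&\quad+\sum_{n=0}^\infty\frac{(-1)^{|k|}}{n!(n+|k|)!}\left({}_1\psi_1\left[\begin{matrix}(1,\alpha_1);\\(1-n,\alpha_1);\end{matrix}(-\lambda_1^{\alpha_1}t)\right]\right)\left({}_1\psi_1\left[\begin{matrix}(1,\alpha_2);\\(1-n-|k|,\alpha_2);\end{matrix}(-\lambda_2^{\alpha_2}t)\right]\right)\mathbb{I}_{k<0}.\end{aligned}$$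
   Context: $N_1,N_2$ are independent homogeneous Poisson processes with intensities $\lambda_1,\lambda_2$; $D_{\alpha_1},D_{\alpha_2}$ are independent stable subordinators, $\mathbb{E}[e^{-sD_{\alpha_i}(t)}]=e^{-ts^{\alpha_i}}$, independent of $N_1,N_2$. $\mathbb{I}$ denotes an indicator. The Fox–Wright function is $${}_1\psi_1\left[\begin{matrix}(a,\alpha);\\(b,\beta);\end{matrix}(z)\right]=\sum_{r=0}^\infty\frac{\Gamma(a+\alpha r)}{\Gamma(b+\beta r)}\frac{z^r}{r!},$$ with $1/\Gamma$ taken to be $0$ at the poles of $\Gamma$. *)

(* Defs.v *)
From HB Require Import structures.
From mathcomp Require Import all_boot all_order all_algebra.
From mathcomp Require Import all_classical all_reals all_analysis.
Import Order.TTheory GRing.Theory Num.Theory.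
Import numFieldNormedType.Exports.

Set Implicit Arguments.
Unset Strict Implicit.
Unset Printing Implicit Defensive.

Local Open Scope classical_set_scope.
Local Open Scope ring_scope.

Section special_functions.
Context {R : realType}.
Implicit Types (a b x z : R) (alpha beta : R).

(* Euler's integral; only meaningful for 0 < x. *)
Definition Gamma_integral x : R :=
  \int[lebesgue_measure]_(y in `]0, +oo[) (y `^ (x - 1) * expR (- y)).

(* Number of unit shifts bringing x into ]0, +oo[. *)
Definition Gamma_shift x : nat :=
  if 0 < x then 0%N else (Num.truncn (- x)).+1.

(* Gamma on the whole real line, extended to x <= 0 by
   Gamma x = Gamma (x + n) / (x (x + 1) ... (x + n - 1)).
   At the poles 0, -1, -2, ... the product vanishes, hence Gamma x = 0 and
   (Gamma x)^-1 = 0 since 0^-1 = 0: this is the convention 1 / Gamma = 0. *)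
Definition Gamma x : R :=
  Gamma_integral (x + (Gamma_shift x)%:R) / \prod_(i < Gamma_shift x) (x + i%:R).

Lemma Gamma_pole (m : nat) : Gamma (- m%:R) = 0.
Proof.
rewrite /Gamma /Gamma_shift oppr_gt0 ltrn0 opprK natrK.
by rewrite (bigD1 ord_max)//= addNr mul0r invr0 mulr0.
Qed.

Definition fox_wright_term a alpha b beta z (r : nat) : R :=
  Gamma (a + alpha * r%:R) / Gamma (b + beta * r%:R) * (z ^+ r / r`!%:R).

Definition fox_wright a alpha b beta z : R :=
  limn (series (fox_wright_term a alpha b beta z)).

End special_functions.

Section processes.
Context d (T : measurableType d) (R : realType) (P : probability T R).

Definition mutually_independent (I : finType) (F : I -> set (set T)) : Prop :=
  forall (J : {set I}) (A : I -> set T), (forall i, i \in J -> F i (A i)) ->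
    P (\bigcap_(i in [set` J]) A i) = (\prod_(i in J) P (A i))%E.

(* Processes are indexed by R, but only times t >= 0 are ever constrained. *)
Implicit Types (X D : R -> T -> R) (N : R -> T -> nat).

Definition sigma_process X : set (set T) :=
  <<s \bigcup_(t in [set t | 0 <= t]) preimage_set_system setT (X t) measurable >>.

Definition increment X (s t : R) : T -> R := fun w => X t w - X s w.

(* Levy process with nondecreasing right-continuous paths. The path properties
   are required for every w, so that compositions such as N (D t w) w are
   measurable in w. Stochastic continuity follows from right-continuity and
   stationarity, and left limits exist by monotonicity. *)
Record is_subordinator X : Prop := {
  subordinator_measurable : forall t, 0 <= t -> measurable_fun setT (X t);
  subordinator0 : forall w, X 0 w = 0;
  subordinator_nondecreasing : forall w s t, 0 <= s -> s <= t -> X s w <= X t w;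
  subordinator_right_continuous : forall w t, 0 <= t ->
    X s w @[s --> t^'+] --> X t w;
  subordinator_independent_increments : forall (n : nat) (t : nat -> R),
    0 <= t 0%N -> {homo t : i j / (i <= j)%N >-> i <= j} ->
    mutually_independent (fun i : 'I_n =>
      preimage_set_system setT (increment X (t i) (t i.+1)) measurable);
  subordinator_stationary_increments : forall s t (B : set R),
    0 <= s -> s <= t -> measurable B ->
    P (increment X s t @^-1` B) = P (X (t - s) @^-1` B) }.

Definition realvalued N : R -> T -> R := fun t w => (N t w)%:R.

Record is_poisson_process (lambda : R) N : Prop := {
  poisson_process_levy : is_subordinator (realvalued N);
  poisson_process_law : forall t (k : nat), 0 < t ->
    P [set w | N t w = k] = (poisson_pmf (lambda * t) k)%:E }.

Record is_stable_subordinator (alpha : R) D : Prop := {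
  stable_subordinator_levy : is_subordinator D;
  stable_subordinator_laplace : forall t s, 0 <= t -> 0 <= s ->
    ('E_P[fun w => expR (- (s * D t w))] = (expR (- (t * s `^ alpha)))%:E)%E }.

Definition independent_processes N1 N2 D1 D2 : Prop :=
  mutually_independent (tnth [tuple sigma_process (realvalued N1);
    sigma_process (realvalued N2); sigma_process D1; sigma_process D2]).

Definition skellam N1 N2 D1 D2 (t : R) (w : T) : int :=
  (N1 (D1 t w) w)%:Z - (N2 (D2 t w) w)%:Z.

End processes.

(* Main.v *)
Require Import Defs.
From HB Require Import structures.
From mathcomp Require Import all_boot all_order all_algebra.
From mathcomp Require Import all_classical all_reals all_analysis.
From mathcomp Require Import measurable_realfun ring lra zify.
Import Order.TTheory GRing.Theory Num.Theory.
Import numFieldNormedType.Exports.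

Set Implicit Arguments.
Unset Strict Implicit.
Unset Printing Implicit Defensive.

Local Open Scope classical_set_scope.
Local Open Scope ring_scope.

(** A subordinated Poisson variable N (D t) is a mixture of Poisson laws, so
    P (N (D t) = m) = E [(lambda D)^m / m! e^(- lambda D)], D standing for
    D t.  This is, up to the factor (- lambda)^m / m!, the m-th derivative at
    s = lambda of the Laplace transform phi(s) = e^(- t s^alpha) of D.
    Expanding phi as a series in t and differentiating s^(alpha r) produces the
    falling factorials (alpha r) (alpha r - 1) ... (alpha r - m + 1), which are
    the quotients Gamma (1 + alpha r) / Gamma (1 - m + alpha r) of the
    Fox-Wright function.  Hence
    P (N (D t) = m) = (-1)^m / m! 1psi1 [(1, alpha); (1 - m, alpha)]
    (- lambda^alpha t).
    The two subordinated variables are independent, and {S = k} is the disjoint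
    union over n of the events {N1 (D1 t) = n + k, N2 (D2 t) = n}, or of
    {N1 (D1 t) = n, N2 (D2 t) = n + |k|} when k < 0; summing products gives the
    claim, the signs combining into (-1)^(2 n + |k|) = (-1)^|k|.

    Three points carry the proof.

    - The derivatives of phi are never computed by differentiating a series
      term by term.  They have the form s^-m Q_m(- t s^alpha) e^(- t s^alpha)
      for polynomials Q_m given by a recursion (is_derive_touchard), and the
      same recursion yields sum_r (alpha r)_m z^r / r! = Q_m(z) e^z by finite
      algebra, writing the polynomials of r in the basis of natural falling
      factorials (cvg_series_touchard).  The moments E [D^m e^(- s D)] obey the
      same differential relation by differentiation under the integral sign
      (moment_touchard).

    - Gamma is given on the positive half-line by Euler's integral and extended
      by its functional equation, so the ratio above rests on finiteness,
      positivity and Gamma (x + 1) = x Gamma (x) for that integral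
      (Gamma_integralD1, Gamma_ratio).

    - The mixture formula and the independence of N1 (D1 t) and N2 (D2 t) come
      from approximating D t from above by times on the grid of mesh
      1 / (n + 1).  On the grid only countably many values occur and the
      independence hypothesis applies to each cell; as the paths of N are
      integer-valued and right-continuous, the sampled events are eventually
      constant, pointwise, and the formulas pass to the limit by dominated
      convergence (cvg_prob_events, prob_subordinated, indep_subordinated). *)

(** * Falling factorial series and derivatives of exp (- t s^a) *)

Section falling_factorial_series.
Context {R : realType}.
Implicit Types (a z : R) (p : {poly R}).

(** Generalized Touchard polynomials: touchard a m is the polynomial Q such that
    s^m (d/ds)^m e^(c s^a) = Q(c s^a) e^(c s^a) for every constant c; for a = 1
    it is 'X^m. *)
Fixpoint touchard a (m : nat) : {poly R} :=
  if m is m'.+1 then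
    a *: ('X * (touchard a m' + (touchard a m')^`())) - m'%:R *: touchard a m'
  else 1.

(** The linear form sending 'X^j to the falling factorial r^_j: it carries a
    polynomial p to the sequence of r whose exponential generating function is
    p(z) e^z.  Since r^_j vanishes for j > r, the bound r.+1 does not depend on
    p, which makes linearity in p immediate. *)
Definition ffact_form (r : nat) p : R := \sum_(j < r.+1) p`_j * (r ^_ j)%:R.

(** Multiplying a sequence by r amounts to applying z d/dz to p(z) e^z, that
    is, to replacing p by 'X (p + p'). *)
Lemma ffact_formMX r p : ffact_form r ('X * (p + p^`())) = r%:R * ffact_form r p.
Proof.
rewrite /ffact_form big_ord_recl coefXM/= mul0r add0r.
under eq_bigr do rewrite coefXM/= add0n coefD coef_deriv mulrDl.
rewrite big_split/= [RHS]mulr_sumr.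
rewrite [X in X + _](_ : _ = \sum_(i < r.+1) p`_i * (r ^_ i.+1)%:R); last first.
  by rewrite [RHS]big_ord_recr/= ffact_small// mulr0 addr0.
rewrite [X in _ + X](_ : _ = \sum_(i < r.+1) p`_i *+ i * (r ^_ i)%:R); last first.
  by rewrite [RHS]big_ord_recl/= mulr0n mul0r add0r.
rewrite -big_split/=; apply: eq_bigr => i _.
have -> : (r ^_ i.+1)%:R = (r%:R - i%:R) * (r ^_ i)%:R :> R.
  have [ir|ri] := leqP i r; first by rewrite ffactnSr natrM natrB// mulrC.
  by rewrite !ffact_small ?mulr0 // ltnW.
by rewrite -mulr_natr; ring.
Qed.

Lemma ffact_form_touchard a m r :
  ffact_form r (touchard a m) = \prod_(i < m) (a * r%:R - i%:R).
Proof.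
elim: m => [|m IH] /=.
  rewrite big_ord0 /ffact_form big_ord_recl/= coef1 big1 ?addr0 ?mulr1//.
  by move=> i _; rewrite coef1 mul0r.
rewrite big_ord_recr/= -IH.
transitivity (a * ffact_form r ('X * (touchard a m + (touchard a m)^`()))
   - m%:R * ffact_form r (touchard a m)).
  rewrite /ffact_form !mulr_sumr -sumrB; apply: eq_bigr => i _.
  by rewrite coefB !coefZ mulrBl !mulrA.
by rewrite ffact_formMX; ring.
Qed.

Lemma ffact_formE r p : ffact_form r p = \sum_(j < size p) p`_j * (r ^_ j)%:R.
Proof.
pose F i : R := p`_i * (r ^_ i)%:R.
rewrite /ffact_form -(big_mkord xpredT F) -[RHS](big_mkord xpredT F).
have [le|/ltnW le] := leqP r.+1 (size p).
  rewrite [RHS](big_cat_nat (leq0n _) le)//= [X in _ + X]big1_seq ?addr0// => i.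
  by rewrite mem_index_iota => /= /andP[ri _]; rewrite /F ffact_small ?mulr0.
rewrite [LHS](big_cat_nat (leq0n _) le)//= [X in _ + X]big1_seq ?addr0// => i.
by rewrite mem_index_iota => /= /andP[ri _]; rewrite /F nth_default ?mul0r.
Qed.

Lemma cvg_series_expR z : series (exp_coeff z) @ \oo --> expR z.
Proof. by rewrite /expR; exact: is_cvg_series_exp_coeff. Qed.

(** Since r^_j / r! = 1 / (r - j)!, this is the exponential series shifted by
    j. *)
Lemma cvg_series_ffact (j : nat) z :
  series (fun r => (r ^_ j)%:R * (z ^+ r / r`!%:R)) @ \oo --> z ^+ j * expR z.
Proof.
(* The first j terms vanish. *)
rewrite -(cvg_shiftn j).
apply: (@cvg_trans _ (z ^+ j * series (exp_coeff z) n @[n --> \oo])); last first.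
  by apply: cvgMl_tmp; exact: cvg_series_expR.
apply: near_eq_cvg; apply: nearW => n /=.
rewrite !seriesEnat/= (big_cat_nat (leq0n _) (leq_addl n j))//=
  [X in _ = X + _]big1_seq ?add0r; last first.
  by move=> i; rewrite mem_index_iota => /= ij; rewrite ffact_small// mul0r.
rewrite -{2}[j]add0n big_addn addnK mulr_sumr; apply: eq_bigr => i _.
rewrite -(@bin_ffact (i + j)) /exp_coeff/= exprD.
have /eqP := bin_fact (leq_addl i j); rewrite addnK.
move=> /eqP <-; rewrite !natrM.
have h1 : ('C(i + j, j))%:R != 0 :> R by rewrite pnatr_eq0 -lt0n bin_gt0 leq_addl.
have h2 : j`!%:R != 0 :> R by rewrite pnatr_eq0 -lt0n fact_gt0.
have h3 : i`!%:R != 0 :> R by rewrite pnatr_eq0 -lt0n fact_gt0.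
by field; rewrite h1 h2 h3.
Qed.

Lemma cvg_series_touchard a m z :
  series (fun r => \prod_(i < m) (a * r%:R - i%:R) * (z ^+ r / r`!%:R)) @ \oo
    --> (touchard a m).[z] * expR z.
Proof.
set p := touchard a m.
rewrite (_ : series _ = (fun n => \sum_(j < size p) p`_j *
    series (fun r => (r ^_ j)%:R * (z ^+ r / r`!%:R)) n)); last first.
  apply/funext => n; rewrite seriesEnat/=.
  under eq_bigr do rewrite -ffact_form_touchard ffact_formE mulr_suml.
  rewrite exchange_big/=; apply: eq_bigr => j _; rewrite seriesEnat/= mulr_sumr.
  by apply: eq_bigr => i _; rewrite -mulrA.
rewrite horner_coef mulr_suml.
under [X in _ --> X]eq_bigr do rewrite -mulrA.
apply: (@cvg_big _ _ _ _ _ _ _ _ _ (fun (j : 'I_(size p)) n => p`_j *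
    series (fun r => (r ^_ j)%:R * (z ^+ r / r`!%:R)) n)) => [|j _].
  exact: add_continuous.
by apply: cvgMl_tmp; exact: cvg_series_ffact.
Qed.

(** The recursion defining touchard is exactly the product rule for
    s^-m Q(- t s^a) e^(- t s^a). *)
Lemma is_derive_touchard a m (t s : R) : 0 < s ->
  is_derive s 1 (fun s => s ^- m * (touchard a m).[- (t * s `^ a)]
                          * expR (- (t * s `^ a)))
    (s ^- m.+1 * (touchard a m.+1).[- (t * s `^ a)] * expR (- (t * s `^ a))).
Proof.
move=> s0; have s_neq0 : s != 0 by rewrite gt_eqF.
pose u (s : R) := - (t * s `^ a).
have du : is_derive s 1 u (- t * (a * s `^ (a - 1))).
  have -> : u = (- t) *: (@powR R ^~ a) :> (R -> R).
    by apply/funext => x; rewrite /u -mulNr.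
  by apply: is_deriveZ; exact: is_derive1_powR.
have dp := is_derive1_comp (is_derive_poly (touchard a m) (u s)) du.
have de := is_derive1_comp (is_derive_expR (u s)) du.
have dX : is_derive s 1 (fun s : R => s ^- m) (- (m%:R * (s ^- m / s))).
  refine (is_derive_eq (@is_deriveV _ (fun s : R => s ^+ m) _ _ _ _ _) _).
  - by rewrite expf_neq0.
  - rewrite (_ : (fun s : R => s ^+ m) = (@id R) ^+ m); last first.
      by apply/funext => x; rewrite exprfctE.
    exact: is_deriveX.
  - case: m {dp} => [|m]; first by rewrite !mul0r scale0r scaler0 oppr0.
    rewrite -![_ *: _]/(_ * _) /= !exprS.
    by field; rewrite s_neq0 expf_neq0.
refine (is_derive_eq (is_deriveM (is_deriveM dX dp) de) _).
transitivity (s ^- m * (touchard a m).[u s] *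
    (expR (u s) * (- t * (a * s `^ (a - 1)))) + expR (u s) *
    (s ^- m * ((touchard a m)^`().[u s] * (- t * (a * s `^ (a - 1)))) +
     (touchard a m).[u s] * - (m%:R * (s ^- m / s)))) => //.
have -> : s `^ (a - 1) = s `^ a / s.
  by rewrite powRB ?s_neq0 ?implybT// powRr1// ltW.
have -> : s ^- m.+1 = s ^- m / s by rewrite exprS invfM mulrC.
rewrite /= !(hornerN, hornerZ, hornerM, hornerX, hornerD) -/(u s) /u; ring.
Qed.

End falling_factorial_series.

(** * Euler's integral for the Gamma function *)

Section gamma_function.
Context {R : realType}.
Notation mu := (@lebesgue_measure R).
Implicit Types (x y : R).

Definition gamma_kernel x y : R := y `^ (x - 1) * expR (- y).

Lemma gamma_kernel_ge0 x y : 0 <= gamma_kernel x y.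
Proof. by rewrite mulr_ge0 ?expR_ge0 ?powR_ge0. Qed.

Lemma measurable_gamma_kernel x (A : set R) : measurable_fun A (gamma_kernel x).
Proof.
apply: measurable_funTS; apply: measurable_funM; first exact: measurable_powR.
by apply: measurableT_comp => //; exact: measurable_oppr.
Qed.

Lemma is_derive_expRN y : is_derive y 1 (fun y => expR (- y)) (- expR (- y)).
Proof.
refine (is_derive_eq (is_derive1_comp (is_derive_expR (- y)) (is_deriveNid y 1)) _).
by rewrite mulrN mulr1.
Qed.

Lemma continuous_expRN y : {for y, continuous (fun y : R => expR (- y))}.
Proof.
apply/differentiable_continuous/derivable1_diffP.
exact: (@ex_derive _ _ _ _ _ _ _ (is_derive_expRN y)).
Qed.

Lemma continuous_powRl x y : 0 < y -> {for y, continuous (@powR R ^~ x)}.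
Proof.
move=> y0; apply/differentiable_continuous/derivable1_diffP.
by apply: derivable_powR; rewrite in_itv/= y0.
Qed.

Lemma continuous_gamma_kernel x y : 0 < y -> {for y, continuous (gamma_kernel x)}.
Proof.
by move=> y0; apply: cvgM; [exact: continuous_powRl|exact: continuous_expRN].
Qed.

(** Staying away from 0 keeps both kernels continuous, although the one of
    exponent x - 1 is unbounded near 0 when x < 1. *)
Lemma gamma_kernel_by_parts x (a b : R) : 0 < a -> a < b ->
  (\int[mu]_(y in `[a, b]) (gamma_kernel (x + 1) y)%:E
     + (gamma_kernel (x + 1) b - gamma_kernel (x + 1) a)%:E
   = x%:E * \int[mu]_(y in `[a, b]) (gamma_kernel x y)%:E)%E.
Proof.
move=> a0 ab.
have pos y : y \in `[a, b] -> 0 < y.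
  by rewrite in_itv/= => /andP[ay _]; exact: lt_le_trans ay.
have intk z : mu.-integrable `[a, b] (EFin \o gamma_kernel z).
  apply: continuous_compact_integrable; first exact: segment_compact.
  apply: continuous_in_subspaceT => y; rewrite inE => /pos.
  exact: continuous_gamma_kernel.
have ctn y : 0 < y -> {for y, continuous (fun y : R => - expR (- y))}.
  by move=> _; apply: cvgN; exact: continuous_expRN.
have := @integration_by_parts R (@powR R ^~ x) (fun y => - expR (- y))
  (fun y => x * y `^ (x - 1)) (fun y => expR (- y)) a b ab.
move=> /(_ _)/wrap[].
  apply: continuous_in_subspaceT => y; rewrite inE => /pos y0.
  by apply: cvgMl_tmp; exact: continuous_powRl.
move=> /(_ _)/wrap[].
  split.
  - move=> y yab; apply: derivable_powR; rewrite in_itv/= andbT pos//.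
    exact: subset_itv_oo_cc.
  - by apply: cvg_at_right_filter; exact: continuous_powRl.
  - by apply: cvg_at_left_filter; apply: continuous_powRl; rewrite (lt_trans a0).
move=> /(_ _)/wrap[].
  move=> y yab; apply: powR_derive1; rewrite in_itv/= andbT pos//.
  exact: subset_itv_oo_cc.
move=> /(_ _)/wrap[].
  by apply: continuous_subspaceT => y; exact: continuous_expRN.
move=> /(_ _)/wrap[].
  split.
  - by move=> y yab; apply: derivableN; exact: (@ex_derive _ _ _ _ _ _ _ (is_derive_expRN y)).
  - by apply: cvg_at_right_filter; exact: ctn.
  - by apply: cvg_at_left_filter; apply: ctn; rewrite (lt_trans a0).
move=> /(_ _)/wrap[].
  move=> y _; rewrite derive1E deriveN; last exact: (@ex_derive _ _ _ _ _ _ _ (is_derive_expRN y)).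
  by rewrite (@derive_val _ _ _ _ _ _ _ (is_derive_expRN y)) opprK.
rewrite (_ : (fun y : R => (y `^ x * expR (- y))%:E) = EFin \o gamma_kernel (x + 1)); last first.
  by apply/funext => y; rewrite /gamma_kernel /= addrK.
move=> ->.
rewrite [X in (_ - X)%E](_ : _ =
    (- x)%:E * \int[mu]_(y in `[a, b]) (gamma_kernel x y)%:E)%E; last first.
  rewrite -integralZl//; last exact: intk.
  by apply: eq_integral => y _; rewrite -EFinM /gamma_kernel; congr EFin; ring.
rewrite EFinN mulNe oppeK addeAC -EFinD /gamma_kernel addrK.
rewrite [X in (X%:E + _)%E](_ : _ = 0%R) ?add0e//; ring.
Qed.

Let b_ (n : nat) : R := n.+2%:R.
Let a_ (n : nat) : R := n.+2%:R^-1.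
Let I_ n : set R := `[a_ n, b_ n].

Lemma exhaust_itv0y : \bigcup_n I_ n = `]0, +oo[%classic.
Proof.
apply/seteqP; split => y /=.
  move=> [n _]; rewrite /I_/= !in_itv/= andbT => /andP[ay _].
  by rewrite (lt_le_trans _ ay)// invr_gt0.
rewrite in_itv/= andbT => y0.
exists (Num.truncn y + Num.truncn y^-1)%N => //.
rewrite /I_/= in_itv/= /a_ /b_; apply/andP; split.
  rewrite -[leRHS]invrK lef_pV2 ?posrE ?invr_gt0 ?ltr0n//.
  rewrite (le_trans (ltW (truncnS_gt _)))// ler_nat.
  by rewrite ltnS leqW// leq_addl.
rewrite (le_trans (ltW (truncnS_gt _)))// ler_nat.
by rewrite ltnS leqW// leq_addr.
Qed.

Lemma cvg_gamma_kernel_exhaust x :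
  (\int[mu]_(y in I_ n) (gamma_kernel x y)%:E)%E @[n --> \oo] -->
  (\int[mu]_(y in `]0%R, +oo[) (gamma_kernel x y)%:E)%E.
Proof.
rewrite -exhaust_itv0y.
apply: ge0_nondecreasing_set_cvg_integral => //.
- apply/nondecreasing_seqP => n; rewrite subsetEset; apply: subset_itv.
    by rewrite bnd_simp /a_ lef_pV2 ?posrE// ler_nat.
  by rewrite bnd_simp /b_ ler_nat.
- by move=> n; exact: measurable_itv.
- by move=> n; apply/measurable_EFinP; exact: measurable_gamma_kernel.
- by move=> n y _; rewrite lee_fin gamma_kernel_ge0.
Qed.

(** With m >= x, y^(x-1) e^-y <= (m+1)! / y for y >= 1, because
    e^y >= y^(m+1) / (m+1)!. *)
Lemma cvg_gamma_kernel_b x : gamma_kernel x (b_ n) @[n --> \oo] --> 0.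
Proof.
pose m := (Num.truncn x).+1.
apply: (@squeeze_cvgr _ _ _ _ (cst 0) (fun n : nat => m.+1`!%:R * harmonic n)).
- apply: nearW => n; rewrite gamma_kernel_ge0/= /gamma_kernel expRN.
  have b1 : 1 <= b_ n by rewrite /b_ ler1n.
  have b0 : 0 < b_ n by rewrite (lt_le_trans ltr01).
  have H : b_ n ^+ m.+1 / m.+1`!%:R <= expR (b_ n).
    by rewrite (le_trans _ (expR_ge1Dxn m (ltW b0)))// lerDr.
  rewrite ler_pdivrMr ?expR_gt0//.
  have -> : m.+1`!%:R * harmonic n * expR (b_ n) = harmonic n * (m.+1`!%:R * expR (b_ n)).
    by rewrite mulrCA mulrA.
  apply: (@le_trans _ _ (harmonic n * b_ n ^+ m.+1)); last first.
    by rewrite ler_pM2l ?harmonic_gt0// mulrC -ler_pdivrMr// ltr0n fact_gt0.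
  apply: (@le_trans _ _ (b_ n `^ m%:R)).
    apply: ler_powR => //; rewrite lerBlDr (le_trans (ltW (truncnS_gt _)))//.
    by rewrite lerDl.
  rewrite powR_mulrn ?(ltW b0)// (exprS _ m) mulrA ler_peMl ?exprn_ge0 ?(ltW b0)//.
  by rewrite /harmonic/= /b_ ler_pdivlMl// mulr1 ler_nat.
- exact: cvg_cst.
- by rewrite -[X in _ --> X](mulr0 m.+1`!%:R); apply: cvgMl_tmp; exact: cvg_harmonic.
Qed.

Lemma cvg_gamma_kernel_a x : 0 < x -> gamma_kernel (x + 1) (a_ n) @[n --> \oo] --> 0.
Proof.
move=> x0; apply: (@squeeze_cvgr _ _ _ _ (cst 0) (fun n => (a_ n) `^ x)).
- apply: nearW => n; rewrite gamma_kernel_ge0/= /gamma_kernel addrK.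
  by rewrite ler_piMr ?powR_ge0// expR_le1 oppr_le0 invr_ge0.
- exact: cvg_cst.
- have /cvg_at_rightP := powR_cvg0 x0; apply; split.
    by move=> n; rewrite /a_ invr_gt0.
  (* a_ n is the harmonic sequence shifted by one. *)
  have := @cvg_harmonic R; rewrite -(cvg_shiftS); exact.
Qed.

(** The equation is established in the extended reals, by monotone limits of
    compact intervals, so that it can be used to derive finiteness. *)
Lemma integral_gamma_kernelD1 x : 0 < x ->
  (\int[mu]_(y in `]0%R, +oo[) (gamma_kernel (x + 1) y)%:E =
   x%:E * \int[mu]_(y in `]0%R, +oo[) (gamma_kernel x y)%:E)%E.
Proof.
move=> x0.
have H : (\int[mu]_(y in I_ n) (gamma_kernel (x + 1) y)%:E +
   (gamma_kernel (x + 1) (b_ n) - gamma_kernel (x + 1) (a_ n))%:E)%E @[n --> \oo]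
   --> (\int[mu]_(y in `]0%R, +oo[) (gamma_kernel (x + 1) y)%:E + (0 - 0)%:E)%E.
  apply: cvgeD.
  - by rewrite fin_num_adde_defl.
  - exact: cvg_gamma_kernel_exhaust.
  - apply: cvg_EFin; first exact: nearW.
    by apply: cvgB; [exact: cvg_gamma_kernel_b|exact: cvg_gamma_kernel_a].
have K : (\int[mu]_(y in I_ n) (gamma_kernel (x + 1) y)%:E +
   (gamma_kernel (x + 1) (b_ n) - gamma_kernel (x + 1) (a_ n))%:E)%E @[n --> \oo]
   --> (x%:E * \int[mu]_(y in `]0%R, +oo[) (gamma_kernel x y)%:E)%E.
  under eq_cvg.
    move=> n; rewrite gamma_kernel_by_parts; first over.
    + by rewrite /a_ invr_gt0.
    + by rewrite /a_ /b_ (@le_lt_trans _ _ 1)// ?invf_le1// ?ltr1n ?ler1n.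
  by apply: cvgeZl => //; exact: cvg_gamma_kernel_exhaust.
by rewrite -(cvg_unique _ H K)// subr0 adde0.
Qed.

Lemma integral_gamma_kernel1 :
  (\int[mu]_(y in `]0%R, +oo[) (gamma_kernel 1 y)%:E = 1)%E.
Proof.
rewrite -(@integral_exponential_pdf R 1)// integral_itv_obnd_cbnd; last first.
  by apply/measurable_EFinP; exact: measurable_gamma_kernel.
rewrite integral_mkcond; apply: eq_integral => y _.
rewrite /exponential_pdf !patchE; case: ifPn => // _.
by rewrite /gamma_kernel subrr powRr0 mulN1r.
Qed.

(** For x <= 1 the functional equation reduces finiteness at x to finiteness at
    x + 1, where y^x <= 1 + y bounds the integral by those at 1 and 2; larger x
    are reached by going up one unit at a time. *)
Lemma integral_gamma_kernel_fin x : 0 < x ->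
  (\int[mu]_(y in `]0%R, +oo[) (gamma_kernel x y)%:E < +oo)%E.
Proof.
(* As z * +oo = +oo for z > 0, finiteness descends from z + 1 to z. *)
have shift z : 0 < z ->
    (\int[mu]_(y in `]0%R, +oo[) (gamma_kernel (z + 1) y)%:E < +oo)%E ->
    (\int[mu]_(y in `]0%R, +oo[) (gamma_kernel z y)%:E < +oo)%E.
  move=> z0; rewrite (integral_gamma_kernelD1 z0) !ltey; apply: contra => /eqP ->.
  by rewrite gt0_muley// lte_fin.
have small z : 0 < z -> z <= 1 ->
    (\int[mu]_(y in `]0%R, +oo[) (gamma_kernel z y)%:E < +oo)%E.
  move=> z0 z1; apply: shift => //.
  have m1 (w : R) : measurable_fun (`]0%R, +oo[ : set R) (fun y => (gamma_kernel w y)%:E).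
    by apply/measurable_EFinP; exact: measurable_gamma_kernel.
  apply: (@le_lt_trans _ _ (\int[mu]_(y in `]0%R, +oo[)
      ((gamma_kernel 1 y)%:E + (gamma_kernel (1 + 1) y)%:E))%E).
    apply: ge0_le_integral => //=.
    - by move=> y _; rewrite lee_fin gamma_kernel_ge0.
    - exact: m1.
    - exact: (emeasurable_funD (m1 1) (m1 (1 + 1))).
    move=> y; rewrite in_itv/= andbT => y0.
    rewrite lee_fin /gamma_kernel -mulrDl ler_pM2r ?expR_gt0// !addrK subrr.
    rewrite powRr0 powRr1 ?(ltW y0)//.
    have [y1|/ltW y1] := leP y 1.
      by rewrite (@le_trans _ _ 1) ?lerDl ?(ltW y0)// -(powRr0 y) ger_powR ?y0 ?y1// ltW.
    by rewrite (@le_trans _ _ y) ?lerDr// -[leRHS]powRr1 ?(ltW y0)// ler_powR.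
  rewrite ge0_integralD//=.
  - by rewrite (integral_gamma_kernelD1 ltr01) integral_gamma_kernel1 mule1 ltry.
  - by move=> y _; rewrite lee_fin gamma_kernel_ge0.
  - exact: m1.
  - by move=> y _; rewrite lee_fin gamma_kernel_ge0.
  - exact: m1.
suff H n z : 0 < z -> z <= n.+1%:R ->
    (\int[mu]_(y in `]0%R, +oo[) (gamma_kernel z y)%:E < +oo)%E.
  by move=> x0; apply: (H (Num.truncn x)) => //; exact/ltW/truncnS_gt.
elim: n z => [|n IH] z z0 zn; first exact: small.
have [z1|z1] := leP z 1; first exact: small.
rewrite -(subrK 1 z) integral_gamma_kernelD1 ?subr_gt0//.
apply: lte_mul_pinfty => //; first by rewrite lee_fin subr_ge0 ltW.
by apply: IH; rewrite ?subr_gt0// lerBlDr natr1.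
Qed.

(** On [1, 2] the kernel is at least e^-2 / 2, since y^(x-1) >= 1 / y there. *)
Lemma Gamma_integral_gt0 x : 0 < x -> 0 < Gamma_integral x.
Proof.
move=> x0; apply: fine_gt0; rewrite integral_gamma_kernel_fin// andbT.
pose c : R := 2^-1 * expR (- 2).
have c0 : 0 < c by rewrite mulr_gt0// expR_gt0.
apply: (@lt_le_trans _ _ (\int[mu]_(y in `[1%R, 2%R]) (cst c%:E) y)%E).
  rewrite integral_cst//= lebesgue_measure_itv/= lte_fin ltr1n -EFinB.
  by rewrite -EFinM lte_fin mulr_gt0// subr_gt0 ltr1n.
have sub : (`[1, 2] : set R) `<=` (`]0, +oo[ : set R).
  by move=> y /=; rewrite !in_itv/= andbT => /andP[y1 _]; exact: lt_le_trans y1.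
apply: (@le_trans _ _ (\int[mu]_(y in `[1%R, 2%R]) (gamma_kernel x y)%:E)%E).
  apply: ge0_le_integral => //=.
  - by move=> y _; rewrite lee_fin ltW.
  - by apply/measurable_EFinP; exact: measurable_gamma_kernel.
  move=> y; rewrite in_itv/= => /andP[y1 y2]; rewrite lee_fin.
  have y0 : 0 < y by exact: lt_le_trans y1.
  apply: ler_pM; rewrite ?expR_ge0 ?invr_ge0// ?ler_expR ?lerN2//.
  apply: (@le_trans _ _ (y `^ (-1))).
    by rewrite powR_inv1 ?(ltW y0)// lef_pV2 ?posrE.
  by rewrite ler_powR// lerDr ltW.
apply: ge0_subset_integral => //=.
  by apply/measurable_EFinP; exact: measurable_gamma_kernel.
by move=> y _; rewrite lee_fin gamma_kernel_ge0.
Qed.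

Lemma Gamma_integralD1 x : 0 < x -> Gamma_integral (x + 1) = x * Gamma_integral x.
Proof.
move=> x0; rewrite /Gamma_integral /Rintegral.
rewrite (integral_gamma_kernelD1 x0) fineM// ge0_fin_numE ?integral_gamma_kernel_fin//.
by apply: integral_ge0 => y _; rewrite lee_fin gamma_kernel_ge0.
Qed.

End gamma_function.

(** * Gamma quotients and the Fox-Wright function *)

Section fox_wright_series.
Context {R : realType}.
Implicit Types (x a z : R).

Lemma Gamma_shift_le0 x : x <= 0 -> Gamma_shift x = (Gamma_shift (x + 1)).+1.
Proof.
move=> x0; rewrite /Gamma_shift ltNge x0/=; congr S.
have [x1|x1] := ltP 0 (x + 1).
  by apply: truncn_def; rewrite oppr_ge0 x0/= ltrNl -subr_gt0 opprK.
have x1' : 0 <= - (x + 1) by rewrite oppr_ge0.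
have -> : - x = 1 + - (x + 1) by ring.
by rewrite truncnD ?nnegrE// truncn1 add1n.
Qed.

(** In this form the functional equation holds on the whole line: at the poles
    both sides are 0, in accordance with 1 / Gamma = 0. *)
Lemma invr_Gamma x : (Gamma x)^-1 = x / Gamma (x + 1).
Proof.
have [x0|x0] := ltP 0 x.
  rewrite /Gamma /Gamma_shift x0 addr_gt0// !big_ord0 !addr0 !invr1 !mulr1.
  rewrite Gamma_integralD1// invfM mulrA divff ?mul1r//.
  by rewrite gt_eqF.
rewrite /Gamma (Gamma_shift_le0 x0); set n := Gamma_shift (x + 1).
rewrite !invf_div big_ord_recl/= addr0 mulrA; congr (_ * _ / _).
  apply: eq_bigr => i _; rewrite /bump/= add1n -natr1; ring.
by congr Gamma_integral; rewrite -natr1; ring.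
Qed.

Lemma Gamma_gt0 x : 0 < x -> 0 < Gamma x.
Proof.
by move=> x0; rewrite /Gamma /Gamma_shift x0 big_ord0 addr0 divr1 Gamma_integral_gt0.
Qed.

Lemma Gamma_ratio x (m : nat) : 0 < x ->
  Gamma x / Gamma (x - m%:R) = \prod_(i < m) (x - 1 - i%:R).
Proof.
move=> x0; elim: m => [|m IH].
  by rewrite subr0 big_ord0 divff// gt_eqF// Gamma_gt0.
rewrite big_ord_recr/= -IH invr_Gamma.
have -> : x - m.+1%:R + 1 = x - m%:R by rewrite -natr1; ring.
by rewrite -natr1; ring.
Qed.

Lemma fox_wright_termE a z (m r : nat) : 0 < a ->
  fox_wright_term 1 a (1 - m%:R) a z r
  = \prod_(i < m) (a * r%:R - i%:R) * (z ^+ r / r`!%:R).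
Proof.
move=> a0; rewrite /fox_wright_term [1 - _ + _]addrAC Gamma_ratio; last first.
  by rewrite ltr_pwDl// mulr_ge0 // ltW.
by congr (_ * _); apply: eq_bigr => i _; ring.
Qed.

(** The Fox-Wright series with first lower parameter 1 - m is elementary: a
    polynomial times an exponential. *)
Lemma cvg_series_fox_wright a z (m : nat) : 0 < a ->
  series (fox_wright_term 1 a (1 - m%:R) a z) @ \oo -->
  (touchard a m).[z] * expR z.
Proof.
move=> a0; rewrite (_ : fox_wright_term _ _ _ _ _ =
    fun r => \prod_(i < m) (a * r%:R - i%:R) * (z ^+ r / r`!%:R)).
  exact: cvg_series_touchard.
by apply/funext => r; exact: fox_wright_termE.
Qed.

Lemma fox_wrightE a z (m : nat) : 0 < a ->
  fox_wright 1 a (1 - m%:R) a z = (touchard a m).[z] * expR z.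
Proof. by move=> a0; apply/cvg_lim => //; exact: cvg_series_fox_wright. Qed.

End fox_wright_series.

(** * Laplace moments of a stable variable *)

Section laplace_moments.
Context d (T : measurableType d) (R : realType) (P : probability T R).
Variables (D : T -> R) (t a : R).
Hypothesis mD : measurable_fun setT D.
Hypothesis D_ge0 : forall w, 0 <= D w.
Hypothesis laplaceD : forall s, 0 < s ->
  (\int[P]_w expR (- (s * D w)))%R = expR (- (t * s `^ a)).

(** This bound, uniform in x, serves both for integrability of the moments and
    as dominating constant when differentiating under the integral. *)
Lemma exprn_expRN_le (x s : R) (m : nat) : 0 <= x -> 0 < s ->
  x ^+ m * expR (- (s * x)) <= m`!%:R / s ^+ m.
Proof.
move=> x0 s0; rewrite expRN ler_pdivrMr ?expR_gt0// mulrAC ler_pdivlMr ?exprn_gt0//.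
rewrite -exprMn [x * s]mulrC [leRHS]mulrC -ler_pdivrMr ?ltr0n ?fact_gt0//.
have sx0 : 0 <= s * x by rewrite mulr_ge0// ltW.
case: m => [|m].
  by rewrite expr0 fact0 mul1r invr1 (le_trans _ (expR_ge1Dx _))// lerDl.
by rewrite (le_trans _ (expR_ge1Dxn m sx0))// lerDr.
Qed.

Lemma measurable_moment (m : nat) (s : R) :
  measurable_fun setT (fun w => D w ^+ m * expR (- (s * D w))).
Proof.
apply: measurable_funM; first exact: measurable_funX.
apply: measurableT_comp => //; apply: measurableT_comp => //.
exact: measurable_funM.
Qed.

Lemma integrable_moment (m : nat) (s : R) : 0 < s ->
  P.-integrable setT (EFin \o (fun w => D w ^+ m * expR (- (s * D w)))).
Proof.
move=> s0; apply: measurable_bounded_integrable => //.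
- by rewrite -ge0_fin_numE ?fin_num_measure.
- exact: measurable_moment.
exists (m`!%:R / s ^+ m); split; first exact: num_real.
move=> M M0 w _; rewrite /= ger0_norm ?mulr_ge0 ?expR_ge0 ?exprn_ge0//.
by rewrite (le_trans _ (ltW M0))// exprn_expRN_le.
Qed.

Lemma is_derive_moment (m : nat) (s x : R) :
  is_derive s 1 (fun s => x ^+ m * expR (- (s * x)))
    (- (x ^+ m.+1 * expR (- (s * x)))).
Proof.
have du : is_derive s 1 (fun s => - (s * x)) (- x).
  rewrite (_ : (fun s => - (s * x)) = (- x) *: @id R); last first.
    by apply/funext => y; rewrite scalrfctE -[RHS]/(- x * y); ring.
  refine (is_derive_eq (is_deriveZ _ (is_derive_id s 1)) _).
  by rewrite -[LHS]/(- x * 1) mulr1.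
have de := @is_derive1_comp R expR (fun s => - (s * x)) s _ _ (is_derive_expR _) du.
refine (is_derive_eq (is_deriveZ (x ^+ m) de) _).
by rewrite -[LHS]/(x ^+ m * _) exprS; ring.
Qed.

(** Differentiation under the integral sign on ]s / 2, 2 s[, where the
    derivative is bounded by the constant (m+1)! / (s / 2)^(m+1). *)
Lemma derive_moment (m : nat) (s : R) : 0 < s ->
  (fun s => \int[P]_w (D w ^+ m * expR (- (s * D w))))^`()%classic s
  = - \int[P]_w (D w ^+ m.+1 * expR (- (s * D w))).
Proof.
move=> s0.
have d1 s' w : partial1of2 (fun s w => D w ^+ m * expR (- (s * D w))) s' w
    = - (D w ^+ m.+1 * expR (- (s' * D w))).
  rewrite /partial1of2 derive1E.
  by have := is_derive_moment m s' (D w) => -[].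
have s2 : 0 < s / 2 by rewrite divr_gt0.
have Is : `](s / 2), (s * 2)[%classic s.
  by rewrite /= in_itv/= ltr_pdivrMr// ltr_pMr// ltr1n.
rewrite (@differentiation_under_integral R d T P
   (fun s w => D w ^+ m * expR (- (s * D w))) setT measurableT s (s / 2) (s * 2)
   Is _ _ (cst (m.+1`!%:R / (s / 2) ^+ m.+1))).
- rewrite (_ : (fun y => _ s y) = fun w => - 1 * (D w ^+ m.+1 * expR (- (s * D w)))).
    by rewrite RintegralZl ?mulN1r//; exact: integrable_moment.
  by apply/funext => w; rewrite d1 mulN1r.
- move=> s'; rewrite /= in_itv/= => /andP[ss _].
  by apply: integrable_moment; rewrite (lt_trans _ ss).
- by move=> s' w _ _; have := is_derive_moment m s' (D w) => -[].
- by move=> w; rewrite /= divr_ge0// exprn_ge0// ltW.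
- by apply: finite_measure_integrable_cst.
- move=> s' w; rewrite /= in_itv/= => /andP[ss _] _; rewrite d1 normrN.
  have s'0 : 0 < s' by rewrite (lt_trans _ ss).
  rewrite ger0_norm ?mulr_ge0 ?expR_ge0 ?exprn_ge0//.
  rewrite (le_trans (exprn_expRN_le _ _ s'0))// ler_pM2l ?ltr0n ?fact_gt0//.
  by rewrite lef_pV2 ?posrE ?exprn_gt0// lerXn2r ?nnegrE ?ltW.
Qed.

Lemma moment_touchard (m : nat) (s : R) : 0 < s ->
  (\int[P]_w (D w ^+ m * expR (- (s * D w))))%R
  = (-1) ^+ m * (s ^- m * (touchard a m).[- (t * s `^ a)] * expR (- (t * s `^ a))).
Proof.
elim: m s => [|m IH] s s0.
  under eq_Rintegral do rewrite expr0 mul1r.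
  by rewrite laplaceD// /= hornerC !expr0 invr1 !mul1r.
have dg := is_derive_touchard a m t s0.
apply: oppr_inj; rewrite -derive_moment// derive1E.
rewrite (@near_eq_derive _ _ _ _
  ((-1) ^+ m *: (fun s => s ^- m * (touchard a m).[- (t * s `^ a)] * expR (- (t * s `^ a)))))//; last first.
  by near=> x; apply: IH; near: x; exact: lt_nbhsr.
rewrite deriveZ; last by case: dg.
case: dg => _ ->.
by rewrite -[LHS]/((-1) ^+ m * _) (exprS (-1) m) mulN1r mulNr opprK.
Unshelve. all: by end_near. Qed.

Lemma moment_fox_wright (k : nat) (lambda : R) : 0 < a -> 0 < lambda ->
  (\int[P]_w ((lambda * D w) ^+ k * k`!%:R^-1 * expR (- (lambda * D w)))%:E)%E
  = ((-1) ^+ k / k`!%:R *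
     fox_wright 1 a (1 - k%:R) a (- (lambda `^ a * t)))%:E.
Proof.
move=> a0 l0.
rewrite (_ : (fun w => _) =
    fun w => ((lambda ^+ k / k`!%:R)%:E * (D w ^+ k * expR (- (lambda * D w)))%:E)%E); last first.
  by apply/funext => w; rewrite -EFinM; congr EFin; rewrite exprMn; ring.
have iD := integrable_moment k l0.
rewrite integralZl// -[X in (_ * X)%E]fineK; last exact: integrable_fin_num.
rewrite -EFinM; congr EFin; rewrite [X in _ * X]moment_touchard//.
rewrite fox_wrightE// [lambda `^ a * t]mulrC.
have lk : lambda ^+ k != 0 by rewrite expf_neq0// gt_eqF.
by field; rewrite lk/= pnatr_eq0 -lt0n fact_gt0.
Qed.

End laplace_moments.

(** * Poisson processes sampled at an independent random time *)

Section events.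
Context d (T : measurableType d) (R : realType) (P : probability T R).

(** Pointwise eventual agreement of events is convergence of their indicators;
    the limit event is the inferior limit, hence measurable. *)
Lemma cvg_prob_events (E_ : nat -> set T) (E : set T) :
  (forall n, measurable (E_ n)) ->
  (forall w, \forall n \near \oo, E_ n w <-> E w) ->
  measurable E /\ P (E_ n) @[n --> \oo] --> P E.
Proof.
move=> mE_ E_E.
have EE : E = \bigcup_n \bigcap_(k in [set k | (n <= k)%N]) E_ k.
  apply/seteqP; split => w.
    move=> Ew; have [n _ H] := E_E w; exists n => // k nk.
    by apply/H.
  move=> [n _ nE]; have [m _ H] := E_E w.
  by apply/(H (maxn n m)); rewrite /= ?leq_maxr//; apply: nE; rewrite /= leq_maxl.
have mE : measurable E.
  rewrite EE; apply: bigcup_measurable => n _.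
  by apply: bigcap_measurable => [|k _]; [exists n => /=|exact: mE_].
split => //.
rewrite -(setIT E) -(integral_indic P measurableT)//.
rewrite (_ : (fun n => P (E_ n)) = fun n => (\int[P]_w (\1_(E_ n) w)%:E)%E); last first.
  by apply/funext => n; rewrite integral_indic// setIT.
apply: (@dominated_cvg _ _ _ P setT measurableT _ _ (cst 1%E)) => //.
- by move=> n; apply/measurable_EFinP; exact: measurable_indic.
- move=> w _; apply: cvg_near_cst; have := E_E w; apply: filterS => n EnE.
  rewrite !indicE; congr (_%:R%:E); congr nat_of_bool.
  by apply/idP/idP; rewrite !inE => /EnE.
- exact: finite_measure_integrable_cst.
- by move=> n w _ /=; rewrite lee_fin indicE ger0_norm// lern1; case: (_ \in _).
Qed.

Lemma indep_bigcup (U : nat -> set T) (V : set T) :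
  (forall i, measurable (U i)) -> trivIset setT U -> measurable V ->
  (forall i, P (U i `&` V) = P (U i) * P V)%E ->
  (P (\bigcup_i U i `&` V) = P (\bigcup_i U i) * P V)%E.
Proof.
move=> mU tU mV UV.
rewrite setI_bigcupl measure_bigcup//; last 2 first.
- by move=> i _; exact: measurableI.
- exact: trivIset_setIr.
rewrite [X in (X * _)%E]measure_bigcup//=.
have PV : P V \is a fin_num by exact: fin_num_measure.
rewrite [RHS]muleC -(fineK PV) -nneseriesZl//.
by apply: eq_eseriesr => i _; rewrite UV muleC fineK.
Qed.

End events.

Section discretization.
Context d (T : measurableType d) (R : realType) (P : probability T R).
Variables (N : R -> T -> nat) (D : T -> R) (lambda : R).
Hypothesis lambda_gt0 : 0 < lambda.
Hypothesis D_ge0 : forall w, 0 <= D w.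
Hypothesis mD : measurable_fun setT D.
Hypothesis N_right_continuous : forall w x, 0 <= x ->
  realvalued N s w @[s --> x^'+] --> realvalued N x w.
Hypothesis mN : forall s m, 0 <= s -> measurable [set w | N s w = m].
Hypothesis lawN : forall s m, 0 < s ->
  P [set w | N s w = m] = (poisson_pmf (lambda * s) m)%:E.

Definition grid_index (n : nat) (w : T) : nat := Num.truncn (D w * n.+1%:R).

Definition grid_point (n i : nat) : R := i.+1%:R / n.+1%:R.

(** The grid point used for D w is the first one strictly above D w, never
    D w itself: this is what right-continuity of N requires, and it keeps the
    sampling times positive, where the law of N is known. *)
Definition upper_time (n : nat) (w : T) : R := grid_point n (grid_index n w).

Definition grid_cell (n i : nat) : set T := [set w | grid_index n w = i].

Definition grid_slice (n m i : nat) : set T :=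
  grid_cell n i `&` [set w | N (grid_point n i) w = m].

Definition sampled_event (n m : nat) : set T :=
  [set w | N (upper_time n w) w = m].

Hypothesis indepND : forall n m i,
  (P (grid_slice n m i) =
   P (grid_cell n i) * P [set w | N (grid_point n i) w = m])%E.

Lemma grid_point_gt0 n i : 0 < grid_point n i.
Proof. by rewrite divr_gt0. Qed.

Lemma grid_cellE n i :
  grid_cell n i = D @^-1` `[i%:R / n.+1%:R, i.+1%:R / n.+1%:R[%classic.
Proof.
apply/seteqP; split => w; rewrite /grid_cell /grid_index /= in_itv/=.
  move=> <-; rewrite ler_pdivrMr// ltr_pdivlMr//.
  by apply: truncn_itv; rewrite mulr_ge0.
by rewrite ler_pdivrMr// ltr_pdivlMr// => H; exact: truncn_def.
Qed.

Lemma measurable_grid_cell n i : measurable (grid_cell n i).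
Proof. by rewrite grid_cellE -[X in measurable X]setTI; exact: mD. Qed.

Lemma measurable_grid_slice n m i : measurable (grid_slice n m i).
Proof.
apply: measurableI; first exact: measurable_grid_cell.
by apply: mN; exact/ltW/grid_point_gt0.
Qed.

Lemma trivIset_grid_cell n : trivIset setT (grid_cell n).
Proof. by move=> i j _ _ [w [/= <- <-]]. Qed.

Lemma trivIset_grid_slice n m : trivIset setT (grid_slice n m).
Proof. by move=> i j _ _ [w [[/= <- _] [/= <- _]]]. Qed.

Lemma bigcup_grid_cell n : \bigcup_i grid_cell n i = setT.
Proof. by apply/seteqP; split => // w _; exists (grid_index n w). Qed.

Lemma sampled_eventE n m : sampled_event n m = \bigcup_i grid_slice n m i.
Proof.
apply/seteqP; split => w; first by move=> H; exists (grid_index n w).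
by move=> [i _ [/= <-]].
Qed.

Lemma measurable_sampled_event n m : measurable (sampled_event n m).
Proof.
rewrite sampled_eventE; apply: bigcup_measurable => i _.
exact: measurable_grid_slice.
Qed.

Lemma upper_time_gt n w : D w < upper_time n w.
Proof. by rewrite /upper_time /grid_point ltr_pdivlMr// truncnS_gt. Qed.

Lemma upper_time_le n w : upper_time n w <= D w + harmonic n.
Proof.
rewrite /upper_time /grid_point -natr1 mulrDl mul1r lerD2r ler_pdivrMr//.
by rewrite truncn_le mulr_ge0.
Qed.

Lemma cvg_upper_time w : upper_time n w @[n --> \oo] --> D w.
Proof.
apply: (@squeeze_cvgr _ _ _ _ (cst (D w)) (fun n => D w + harmonic n)).
- by apply: nearW => n; rewrite (ltW (upper_time_gt n w)) upper_time_le.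
- exact: cvg_cst.
- by rewrite -[X in _ --> X]addr0; apply: cvgD; [exact: cvg_cst|exact: cvg_harmonic].
Qed.

(** Right-continuity brings N (upper_time n w) w within distance 1 of
    N (D w) w, and both are integers. *)
Lemma near_sampled_event m w :
  \forall n \near \oo, sampled_event n m w <-> N (D w) w = m.
Proof.
have /cvg_at_rightP/(_ (fun n => upper_time n w)) := @N_right_continuous w _ (D_ge0 w).
move=> /(_ (conj (fun n => upper_time_gt n w) (@cvg_upper_time w))).
move=> /cvgrPdist_lt/(_ 1 ltr01); apply: filterS => n.
rewrite /realvalued /sampled_event/= => H.
suff -> : N (upper_time n w) w = N (D w) w by [].
apply/eqP; rewrite eqn_leq; move: H; rewrite ltr_norml => /andP[H1 H2].
rewrite -ltnS -[X in _ && X]ltnS -!(ltr_nat R) -!natr1.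
by apply/andP; split; lra.
Qed.

(** Agrees with poisson_pmf (lambda * x) m when x > 0 and is continuous in x up
    to x = 0, where poisson_pmf takes the value 1 for every m. *)
Definition poisson_weight (m : nat) (x : R) : R :=
  (lambda * x) ^+ m * m`!%:R^-1 * expR (- (lambda * x)).

Lemma poisson_weight_ge0 m x : 0 <= x -> 0 <= poisson_weight m x.
Proof.
move=> x0; have lx : 0 <= lambda * x by rewrite mulr_ge0// ltW.
by rewrite /poisson_weight mulr_ge0 ?expR_ge0// mulr_ge0 ?exprn_ge0.
Qed.

Lemma poisson_weight_le1 m x : 0 <= x -> poisson_weight m x <= 1.
Proof.
move=> x0; have lx : 0 <= lambda * x by rewrite mulr_ge0// ltW.
rewrite /poisson_weight mulrAC ler_pdivrMr ?ltr0n ?fact_gt0// mul1r.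
by have := exprn_expRN_le m lx ltr01; rewrite mul1r expr1n divr1.
Qed.

Lemma upper_time_ge0 n w : 0 <= upper_time n w.
Proof. exact: (ltW (grid_point_gt0 _ _)). Qed.

Lemma measurable_poisson_weight_upper n m :
  measurable_fun setT (fun w => poisson_weight m (upper_time n w)).
Proof.
move=> _ B _; rewrite setTI.
rewrite (_ : _ @^-1` B = \bigcup_(i in [set i | B (poisson_weight m (grid_point n i))])
    grid_cell n i).
  by apply: bigcup_measurable => i _; exact: measurable_grid_cell.
apply/seteqP; split => w /=; first by move=> H; exists (grid_index n w).
by move=> [i /= Bi iw]; rewrite /upper_time iw.
Qed.

(** Summing over the cells: both sides are the series of the products of
    P (grid_cell n i) and the Poisson weight at grid_point n i. *)
Lemma prob_sampled_event n m :
  P (sampled_event n m) = (\int[P]_w (poisson_weight m (upper_time n w))%:E)%E.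
Proof.
have pmfE i : poisson_pmf (lambda * grid_point n i) m =
    poisson_weight m (grid_point n i).
  by rewrite /poisson_pmf mulr_gt0// grid_point_gt0.
rewrite sampled_eventE measure_bigcup//=; last 2 first.
- by move=> i _; exact: measurable_grid_slice.
- exact: trivIset_grid_slice.
rewrite -(bigcup_grid_cell n) ge0_integral_bigcup//=; last 4 first.
- exact: measurable_grid_cell.
- apply/measurable_EFinP; apply: measurable_funTS.
  exact: measurable_poisson_weight_upper.
- by move=> w _; rewrite lee_fin poisson_weight_ge0// upper_time_ge0.
- exact: trivIset_grid_cell.
rewrite (@eq_eseriesl _ _ xpredT); last by move=> i; rewrite in_setT.
apply: eq_eseriesr => i _.
rewrite indepND lawN ?grid_point_gt0// pmfE.
rewrite (@eq_integral _ _ _ _ _ (cst (poisson_weight m (grid_point n i))%:E)).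
  by rewrite integral_cst; [rewrite muleC|exact: measurable_grid_cell].
by move=> w; rewrite inE /grid_cell/= /upper_time => ->.
Qed.

Lemma prob_subordinated (m : nat) :
  P [set w | N (D w) w = m] = (\int[P]_w (poisson_weight m (D w))%:E)%E.
Proof.
have [_ cE] := @cvg_prob_events _ _ _ P (sampled_event ^~ m)
  [set w | N (D w) w = m] (measurable_sampled_event ^~ m) (near_sampled_event m).
apply: (cvg_unique _ cE) => //.
rewrite (_ : (fun n => _) = fun n =>
    (\int[P]_w (poisson_weight m (upper_time n w))%:E)%E); last first.
  by apply/funext => n; exact: prob_sampled_event.
apply: (@dominated_cvg _ _ _ P setT measurableT _ _ (cst 1%E)) => //.
- move=> n; apply/measurable_EFinP; exact: measurable_poisson_weight_upper.
- move=> w _; apply: cvg_EFin; first exact: nearW.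
  have cl : lambda * upper_time n w @[n --> \oo] --> lambda * D w.
    by apply: cvgMl_tmp; exact: cvg_upper_time.
  apply: cvgM; last first.
    exact: (@continuous_cvg _ _ _ _ _ _ (fun x => expR (- x)) _ (@continuous_expRN R _) cl).
  apply: cvgM; last exact: cvg_cst.
  exact: (cvg_comp _ _ cl (@exprn_continuous R m (lambda * D w))).
- exact: finite_measure_integrable_cst.
- move=> n w _ /=; rewrite lee_fin ger0_norm ?poisson_weight_ge0 ?upper_time_ge0//.
  by rewrite poisson_weight_le1// upper_time_ge0.
Qed.

End discretization.

(** * The space-fractional Skellam process *)

Section subordinator_facts.
Context d (T : measurableType d) (R : realType) (P : probability T R).
Implicit Types (X D : R -> T -> R) (N : R -> T -> nat).

Lemma subordinator_ge0 D t w : is_subordinator P D -> 0 <= t -> 0 <= D t w.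
Proof.
move=> sD t0; rewrite -(subordinator0 sD w).
exact: (subordinator_nondecreasing sD).
Qed.

Lemma Rintegral_stable_laplace a D t s : is_stable_subordinator P a D ->
  0 <= t -> 0 < s ->
  (\int[P]_w expR (- (s * D t w)))%R = expR (- (t * s `^ a)).
Proof.
move=> sD t0 s0; have := stable_subordinator_laplace sD t0 (ltW s0).
by rewrite unlock /Rintegral => ->.
Qed.

Lemma sigma_process_preimage X t (B : set R) : 0 <= t -> measurable B ->
  sigma_process X (X t @^-1` B).
Proof.
move=> t0 mB; apply: sub_sigma_algebra; exists t => //.
by exists B => //; rewrite setTI.
Qed.

Lemma sigma_processT X : sigma_process X setT.
Proof. exact: (sigma_process_preimage (lexx 0) (measurableT : measurable [set: R])). Qed.

Lemma realvalued_preimage N t m :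
  [set w | N t w = m] = realvalued N t @^-1` [set m%:R].
Proof.
apply/seteqP; split => w /=; first by rewrite /realvalued => ->.
by move/eqP; rewrite eqr_nat => /eqP.
Qed.

Lemma sigma_process_level N t m : 0 <= t ->
  sigma_process (realvalued N) [set w | N t w = m].
Proof.
by move=> t0; rewrite realvalued_preimage; exact: sigma_process_preimage.
Qed.

Lemma measurable_level lambda N t m : is_poisson_process P lambda N -> 0 <= t ->
  measurable [set w | N t w = m].
Proof.
move=> pN t0; rewrite realvalued_preimage -[X in measurable X]setTI.
exact: (subordinator_measurable (poisson_process_levy pN) t0).
Qed.

Lemma sigma_process_grid_cell D t n i : (forall w, 0 <= D t w) -> 0 <= t ->
  sigma_process D (grid_cell (D t) n i).
Proof.
by move=> D0 t0; rewrite grid_cellE//; apply: sigma_process_preimage.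
Qed.

Lemma independent_processes4 N1 N2 D1 D2 (A1 A2 B1 B2 : set T) :
  independent_processes P N1 N2 D1 D2 ->
  sigma_process (realvalued N1) A1 -> sigma_process (realvalued N2) A2 ->
  sigma_process D1 B1 -> sigma_process D2 B2 ->
  (P (A1 `&` A2 `&` B1 `&` B2) = P A1 * P A2 * P B1 * P B2)%E.
Proof.
move=> ind sA1 sA2 sB1 sB2.
pose A := tnth [tuple A1; A2; B1; B2].
have := ind [set: 'I_4]%SET A.
have -> : \bigcap_(i in [set` [set: 'I_4]%SET]) A i = A1 `&` A2 `&` B1 `&` B2.
  apply/seteqP; split => w.
    move=> H; do ![split].
    + exact: (H (@Ordinal 4 0 isT) (finset.in_setT _)).
    + exact: (H (@Ordinal 4 1 isT) (finset.in_setT _)).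
    + exact: (H (@Ordinal 4 2 isT) (finset.in_setT _)).
    + exact: (H (@Ordinal 4 3 isT) (finset.in_setT _)).
  by move=> [[[w1 w2] w3] w4] [[|[|[|[|//]]]] i4] _.
move=> ->.
  rewrite (eq_bigl xpredT) => [|i]; last by rewrite finset.in_setT.
  by rewrite !big_ord_recl big_ord0 mule1 !muleA.
by move=> [[|[|[|[|//]]]] i4] _.
Qed.

Lemma independent_poisson_stable1 N1 N2 D1 D2 (A B : set T) :
  independent_processes P N1 N2 D1 D2 ->
  sigma_process (realvalued N1) A -> sigma_process D1 B ->
  (P (A `&` B) = P A * P B)%E.
Proof.
move=> ind sA sB.
have := independent_processes4 ind sA (@sigma_processT (realvalued N2)) sB
  (@sigma_processT D2).
by rewrite !setIT !probability_setT !mule1.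
Qed.

Lemma independent_poisson_stable2 N1 N2 D1 D2 (A B : set T) :
  independent_processes P N1 N2 D1 D2 ->
  sigma_process (realvalued N2) A -> sigma_process D2 B ->
  (P (A `&` B) = P A * P B)%E.
Proof.
move=> ind sA sB.
have := independent_processes4 ind (@sigma_processT (realvalued N1)) sA
  (@sigma_processT D1) sB.
by rewrite setTI !setIT !probability_setT !mule1 mul1e.
Qed.

End subordinator_facts.

Section subordinated_poisson.
Context d (T : measurableType d) (R : realType) (P : probability T R).
Variables (lambda alpha : R) (N : R -> T -> nat) (D : R -> T -> R) (t : R).
Hypotheses (poisson_N : is_poisson_process P lambda N)
  (stable_D : is_stable_subordinator P alpha D) (t_ge0 : 0 <= t).

Let D_ge0 w : 0 <= D t w.
Proof. exact: (subordinator_ge0 w (stable_subordinator_levy stable_D)). Qed.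

Let mD : measurable_fun setT (D t).
Proof. exact: (subordinator_measurable (stable_subordinator_levy stable_D)). Qed.

Let mN s m (s0 : 0 <= s) := measurable_level m poisson_N s0.

Let N_right_continuous w x : 0 <= x ->
  realvalued N s w @[s --> x^'+] --> realvalued N x w.
Proof. exact: (subordinator_right_continuous (poisson_process_levy poisson_N)). Qed.

Lemma measurable_poisson_grid_slice n m i :
  measurable (grid_slice N (D t) n m i).
Proof. exact: measurable_grid_slice. Qed.

Lemma measurable_poisson_sampled n m : measurable (sampled_event N (D t) n m).
Proof. exact: measurable_sampled_event. Qed.

Lemma near_poisson_sampled m w :
  \forall n \near \oo, sampled_event N (D t) n m w <-> N (D t w) w = m.
Proof. exact: near_sampled_event. Qed.

Hypotheses (lambda_gt0 : 0 < lambda) (alpha_gt0 : 0 < alpha).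
Hypothesis indep : forall A B, sigma_process (realvalued N) A ->
  sigma_process D B -> (P (A `&` B) = P A * P B)%E.

Lemma indep_grid_slice n m i : (P (grid_slice N (D t) n m i) =
  P (grid_cell (D t) n i) * P [set w | N (grid_point R n i) w = m])%E.
Proof.
have grid0 : 0 <= grid_point R n i by exact: (ltW (grid_point_gt0 _ _ _)).
rewrite /grid_slice setIC [RHS]muleC; apply: indep.
  exact: sigma_process_level.
exact: sigma_process_grid_cell.
Qed.

Lemma prob_subordinated_fox_wright m :
  P [set w | N (D t w) w = m] = ((-1) ^+ m / m`!%:R *
     fox_wright 1 alpha (1 - m%:R) alpha (- (lambda `^ alpha * t)))%:E.
Proof.
have -> := prob_subordinated lambda_gt0 D_ge0 mD N_right_continuous mN
  (poisson_process_law poisson_N) indep_grid_slice m.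
rewrite (@moment_fox_wright _ _ _ _ _ t alpha)//.
by move=> s s0; exact: Rintegral_stable_laplace stable_D _ _.
Qed.

End subordinated_poisson.

Section independence_of_subordinated.
Context d (T : measurableType d) (R : realType) (P : probability T R).
Variables (lambda1 lambda2 alpha1 alpha2 : R).
Variables (N1 N2 : R -> T -> nat) (D1 D2 : R -> T -> R) (t : R).
Hypotheses (poisson_N1 : is_poisson_process P lambda1 N1)
  (poisson_N2 : is_poisson_process P lambda2 N2)
  (stable_D1 : is_stable_subordinator P alpha1 D1)
  (stable_D2 : is_stable_subordinator P alpha2 D2)
  (indep : independent_processes P N1 N2 D1 D2)
  (t_ge0 : 0 <= t).

(** Both events are disjoint unions of slices, and mutual independence of the
    four processes factors the probability of each pair of slices. *)
Lemma indep_sampled_event n m1 m2 :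
  (P (sampled_event N1 (D1 t) n m1 `&` sampled_event N2 (D2 t) n m2) =
   P (sampled_event N1 (D1 t) n m1) * P (sampled_event N2 (D2 t) n m2))%E.
Proof.
have D1_ge0 w := subordinator_ge0 w (stable_subordinator_levy stable_D1) t_ge0.
have D2_ge0 w := subordinator_ge0 w (stable_subordinator_levy stable_D2) t_ge0.
have grid0 i : 0 <= grid_point R n i by exact: (ltW (grid_point_gt0 _ _ _)).
have mS1 := measurable_poisson_grid_slice poisson_N1 stable_D1 t_ge0 n m1.
have mS2 := measurable_poisson_grid_slice poisson_N2 stable_D2 t_ge0 n m2.
rewrite !sampled_eventE; apply: indep_bigcup => //.
- exact: trivIset_grid_slice.
- exact: bigcupT_measurable.
move=> i; rewrite setIC [RHS]muleC; apply: indep_bigcup => //.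
  exact: trivIset_grid_slice.
move=> j.
rewrite (indep_grid_slice stable_D1 t_ge0); last first.
  by move=> A B; exact: independent_poisson_stable1 indep.
rewrite (indep_grid_slice stable_D2 t_ge0); last first.
  by move=> A B; exact: independent_poisson_stable2 indep.
have H := independent_processes4 indep
  (@sigma_process_level _ _ _ N1 _ m1 (grid0 i))
  (@sigma_process_level _ _ _ N2 _ m2 (grid0 j))
  (sigma_process_grid_cell n i D1_ge0 t_ge0)
  (sigma_process_grid_cell n j D2_ge0 t_ge0).
transitivity (P ([set w | N1 (grid_point R n i) w = m1] `&`
    [set w | N2 (grid_point R n j) w = m2] `&`
    grid_cell (D1 t) n i `&` grid_cell (D2 t) n j)).
  by congr (P _); apply/seteqP; split => w; rewrite /grid_slice /=; tauto.
rewrite [LHS]H -muleA muleACA [RHS]muleC; congr (_ * _)%E; exact: muleC.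
Qed.

Lemma indep_subordinated m1 m2 :
  measurable ([set w | N1 (D1 t w) w = m1] `&` [set w | N2 (D2 t w) w = m2]) /\
  (P ([set w | N1 (D1 t w) w = m1] `&` [set w | N2 (D2 t w) w = m2]) =
   P [set w | N1 (D1 t w) w = m1] * P [set w | N2 (D2 t w) w = m2])%E.
Proof.
have mS1 n := measurable_poisson_sampled poisson_N1 stable_D1 t_ge0 n m1.
have mS2 n := measurable_poisson_sampled poisson_N2 stable_D2 t_ge0 n m2.
have near1 := near_poisson_sampled poisson_N1 stable_D1 t_ge0 m1.
have near2 := near_poisson_sampled poisson_N2 stable_D2 t_ge0 m2.
have [mE1 c1] := cvg_prob_events P mS1 near1.
have [mE2 c2] := cvg_prob_events P mS2 near2.
have near12 w : \forall n \near \oo,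
    (sampled_event N1 (D1 t) n m1 `&` sampled_event N2 (D2 t) n m2) w <->
    ([set w | N1 (D1 t w) w = m1] `&` [set w | N2 (D2 t w) w = m2]) w.
  near=> n.
  have H1 : sampled_event N1 (D1 t) n m1 w <-> N1 (D1 t w) w = m1.
    by near: n; exact: near1.
  have H2 : sampled_event N2 (D2 t) n m2 w <-> N2 (D2 t w) w = m2.
    by near: n; exact: near2.
  by rewrite /setI/=; tauto.
have [_ c12] := cvg_prob_events P (fun n => measurableI _ _ (mS1 n) (mS2 n)) near12.
split; first exact: measurableI.
apply: (cvg_unique _ c12) => //.
rewrite (_ : (fun n => _) = fun n => (P (sampled_event N1 (D1 t) n m1) *
    P (sampled_event N2 (D2 t) n m2))%E); last first.
  by apply/funext => n; exact: indep_sampled_event.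
by apply: cvgeM => //; apply: mule_def_fin; exact: fin_num_measure.
Unshelve. all: by end_near. Qed.

Hypotheses (lambda1_gt0 : 0 < lambda1) (lambda2_gt0 : 0 < lambda2).
Hypotheses (alpha1_gt0 : 0 < alpha1) (alpha2_gt0 : 0 < alpha2).

Let fw1 (m : nat) : R := fox_wright 1 alpha1 (1 - m%:R) alpha1 (- (lambda1 `^ alpha1 * t)).
Let fw2 (m : nat) : R := fox_wright 1 alpha2 (1 - m%:R) alpha2 (- (lambda2 `^ alpha2 * t)).

Lemma joint_subordinated_fox_wright m1 m2 :
  P ([set w | N1 (D1 t w) w = m1] `&` [set w | N2 (D2 t w) w = m2]) =
  ((-1) ^+ (m1 + m2) / (m1`! * m2`!)%:R * fw1 m1 * fw2 m2)%:E.
Proof.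
have [_ ->] := indep_subordinated m1 m2.
rewrite (prob_subordinated_fox_wright poisson_N1 stable_D1)//; last first.
  by move=> A B; exact: independent_poisson_stable1 indep.
rewrite (prob_subordinated_fox_wright poisson_N2 stable_D2)//; last first.
  by move=> A B; exact: independent_poisson_stable2 indep.
rewrite -EFinM; congr EFin; rewrite natrM invfM exprD /fw1 /fw2; ring.
Qed.

(** Countable additivity, with the pairs (a, b) such that a - b = k
    parametrized by n; the two signs of k use different parametrizations. *)
Lemma prob_skellam_series (k : int) (m1 m2 : nat -> nat) (c : nat -> R) :
  injective m1 ->
  (forall a b : nat, a%:Z - b%:Z = k <-> exists n, a = m1 n /\ b = m2 n) ->
  (forall n, c n = (-1) ^+ (m1 n + m2 n) / ((m1 n)`! * (m2 n)`!)%:R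
                   * fw1 (m1 n) * fw2 (m2 n)) ->
  cvgn (series c) /\
  P [set w | skellam N1 N2 D1 D2 t w = k] = (limn (series c))%:E.
Proof.
move=> m1_inj abk cE.
pose U n := [set w | N1 (D1 t w) w = m1 n] `&` [set w | N2 (D2 t w) w = m2 n].
have mU n : measurable (U n) by have [] := indep_subordinated (m1 n) (m2 n).
have tU : trivIset setT U.
  by move=> i j _ _ [w [[/= i1 _] [/= j1 _]]]; apply: m1_inj; rewrite -i1 -j1.
have UE : [set w | skellam N1 N2 D1 D2 t w = k] = \bigcup_n U n.
  apply/seteqP; split => w.
    by move=> /= /abk[n [n1 n2]]; exists n.
  by move=> [n _ [/= n1 n2]]; apply/abk; exists n.
have mUU : measurable (\bigcup_n U n) by exact: bigcupT_measurable.
have PfU : P (\bigcup_n U n) \is a fin_num by exact: fin_num_measure.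
have cU : series c @ \oo --> fine (P (\bigcup_n U n)).
  have H : (\sum_(0 <= i < n) P (U i))%E @[n --> \oo] -->
      (fine (P (\bigcup_n U n)))%:E.
    by rewrite fineK//; exact: (@measure_semi_sigma_additive _ _ _ P _ mU tU mUU).
  rewrite (_ : series c = fine \o (fun n => \sum_(0 <= i < n) P (U i))%E).
    exact: fine_cvg.
  apply/funext => n; rewrite seriesEnat/=.
  under [in RHS]eq_bigr do rewrite joint_subordinated_fox_wright -cE.
  by rewrite sumEFin.
split; first by apply/cvg_ex; exists (fine (P (\bigcup_n U n))).
by rewrite UE (cvg_lim _ cU)// fineK.
Qed.

End independence_of_subordinated.


Theorem theorem7p1 (d : measure_display) (T : measurableType d) (R : realType)
    (P : probability T R) (lambda1 lambda2 alpha1 alpha2 : R)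
    (N1 N2 : R -> T -> nat) (D1 D2 : R -> T -> R) (t : R) (k : int)
    (lambda1_gt0 : 0 < lambda1) (lambda2_gt0 : 0 < lambda2)
    (alpha1_gt0 : 0 < alpha1) (alpha1_lt1 : alpha1 < 1)
    (alpha2_gt0 : 0 < alpha2) (alpha2_lt1 : alpha2 < 1)
    (poisson_N1 : is_poisson_process P lambda1 N1)
    (poisson_N2 : is_poisson_process P lambda2 N2)
    (stable_D1 : is_stable_subordinator P alpha1 D1)
    (stable_D2 : is_stable_subordinator P alpha2 D2)
    (indep : independent_processes P N1 N2 D1 D2)
    (t_ge0 : 0 <= t) :
  let z1 := - (lambda1 `^ alpha1 * t) in
  let z2 := - (lambda2 `^ alpha2 * t) in
  let term_nonneg (n : nat) : R :=
    (-1) ^ k / (n`! * (n + `|k|)`!)%:R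
    * fox_wright 1 alpha1 (1 - n%:R - k%:~R) alpha1 z1
    * fox_wright 1 alpha2 (1 - n%:R) alpha2 z2
    * (0 <= k)%R%:R in
  let term_neg (n : nat) : R :=
    (-1) ^+ `|k| / (n`! * (n + `|k|)`!)%:R
    * fox_wright 1 alpha1 (1 - n%:R) alpha1 z1
    * fox_wright 1 alpha2 (1 - n%:R - `|k|%:R) alpha2 z2
    * (k < 0)%R%:R in
  [/\ forall m : nat,
        cvgn (series (fox_wright_term 1 alpha1 (1 - m%:R) alpha1 z1)),
      forall m : nat,
        cvgn (series (fox_wright_term 1 alpha2 (1 - m%:R) alpha2 z2)),
      cvgn (series term_nonneg),
      cvgn (series term_neg) &
      P [set w | skellam N1 N2 D1 D2 t w = k]
      = (limn (series term_nonneg) + limn (series term_neg))%:E].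
Proof.
move=> z1 z2 term_nonneg term_neg.
have series0 : series (fun=> 0 : R) @ \oo --> (0 : R).
  rewrite (_ : series _ = cst 0); first exact: cvg_cst.
  by apply/funext => n; rewrite seriesEnat/= big1.
have signE (n l : nat) : (-1) ^+ (n + l + n) = (-1) ^+ l :> R.
  by rewrite addnC addnA exprD addnn -signr_odd odd_double mul1r.
suff [cnn cn PE] : [/\ cvgn (series term_nonneg), cvgn (series term_neg) &
    P [set w | skellam N1 N2 D1 D2 t w = k]
      = (limn (series term_nonneg) + limn (series term_neg))%:E].
  split => // m.
  - by apply/cvg_ex; eexists; exact: cvg_series_fox_wright.
  - by apply/cvg_ex; eexists; exact: cvg_series_fox_wright.
have [k0|k0] := leP 0 k.
- have neg0 : term_neg = fun=> 0.
    by apply/funext => n; rewrite /term_neg ltNge k0 mulr0.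
  have kE : k = `|k|%N by rewrite gez0_abs.
  have [|a b|n|cvs ->] := @prob_skellam_series _ _ _ P _ _ _ _ _ _ _ _ t
    poisson_N1 poisson_N2 stable_D1 stable_D2 indep t_ge0 lambda1_gt0 lambda2_gt0
    alpha1_gt0 alpha2_gt0 k (fun n => n + `|k|)%N id term_nonneg.
  + exact: addIn.
  + rewrite kE; split => [H|[n [-> ->]]]; last by lia.
    by exists b; split => //; lia.
  + rewrite /term_nonneg k0 mulr1 signE mulnC.
    have -> : 1 - n%:R - k%:~R = 1 - (n + `|k|)%:R :> R.
      by rewrite [in k%:~R]kE natrD opprD addrA.
    by rewrite [in (-1) ^ k]kE.
  by rewrite neg0 (cvg_lim _ series0)// addr0; split => //; apply/cvg_ex; exists 0.
- have nn0 : term_nonneg = fun=> 0.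
    by apply/funext => n; rewrite /term_nonneg leNgt k0 mulr0.
  have kE : k = - `|k|%N%:Z by rewrite ltz0_abs ?opprK.
  have [|a b|n|cvs ->] := @prob_skellam_series _ _ _ P _ _ _ _ _ _ _ _ t
    poisson_N1 poisson_N2 stable_D1 stable_D2 indep t_ge0 lambda1_gt0 lambda2_gt0
    alpha1_gt0 alpha2_gt0 k id (fun n => n + `|k|)%N term_neg.
  + exact: inj_id.
  + rewrite kE; split => [H|[n [-> ->]]]; last by lia.
    by exists a; split => //; lia.
  + by rewrite /term_neg k0 mulr1 /= (addnC n (n + _)%N) signE natrD opprD addrA.
  by rewrite nn0 (cvg_lim _ series0)// add0r; split => //; apply/cvg_ex; exists 0.
Qed.
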